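(* Let $D$ be a digraph on vertex set $\{1,\dots,n\}$ which contains no loop (that is, no arc of the form $(i,i)$). Then $D$ has sign symmetric $P_{0,1}^+$-completion.
   Context: A real $n\times n$ matrix $A$ is a $P_0^+$-matrix if for every $k\in\{1,\dots,n\}$ every $k\times k$ principal minor of $A$ is nonnegative and at least one $k\times k$ principal minor is positive. A $P_{0,1}^+$-matrix is a $P_0^+$-matrix all of whose diagonal entries are positive. A matrix is sign symmetric if for all $i\neq j$ either $a_{ij}a_{ji}>0$ or $a_{ij}=a_{ji}=0$; entries $a_{ij},a_{ji}$ are called twin entries. A partial matrix is an $n\times n$ array in which some entries are specified (real numbers) and the others are unspecified; a completion is a choice of real values for all unspecified entries. A principal submatrix/minor is fully specified if all its entries are specified. A partial matrix $A$ is a partial sign symmetric $P_{0,1}^+$-matrix if exactly one of the following holds: (i) at least one diagonal entry is unspecified, every pair of fully specified twin entries has positive product or both are zero, and every fully specified principal minor is nonnegative; (ii) all diagonal entries are specified and positive, at least one off-diagonal entry is unspecified, every pair of fully specified twin entries has positive product or both are zero, and every fully specified principal minor is nonnegative; (iii) all entries are specified and $A$ is a sign symmetric $P_{0,1}^+$-matrix. A partial $n\times n$ matrix specifies a digraph $D$ on $\{1,\dots,n\}$ (loops allowed) if for all $i,j$ (including $i=j$) the entry in position $(i,j)$ is specified if and only if $(i,j)$ is an arc of $D$; thus loops correspond to specified diagonal entries. A digraph $D$ has sign symmetric $P_{0,1}^+$-completion if every partial sign symmetric $P_{0,1}^+$-matrix specifying $D$ has a completion that is a sign symmetric $P_{0,1}^+$-matrix.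 *)

(* Defs.v *)
From HB Require Import structures.
From mathcomp Require Import all_boot all_order all_algebra.
From mathcomp Require Import reals.

Set Implicit Arguments.
Unset Strict Implicit.
Unset Printing Implicit Defensive.

Import Order.TTheory GRing.Theory Num.Theory.
Local Open Scope ring_scope.

Section Matrices.
Variables (R : realType) (n : nat).
Implicit Types (A B : 'M[R]_n) (S : {set 'I_n}).

Definition principal_minor A S : R :=
  \det (mxsub (@enum_val _ (mem S)) (@enum_val _ (mem S)) A).

Definition P0plus A : Prop :=
  forall k : nat, (0 < k <= n)%N ->
    (forall S, #|S| = k -> 0 <= principal_minor A S) /\
    (exists S, #|S| = k /\ 0 < principal_minor A S).

Definition P01plus A : Prop :=
  P0plus A /\ forall i, 0 < A i i.

Definition twin_compatible (a b : R) : Prop :=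
  0 < a * b \/ (a = 0 /\ b = 0).

Definition sign_symmetric A : Prop :=
  forall i j, i != j -> twin_compatible (A i j) (A j i).

Definition ss_P01plus A : Prop := sign_symmetric A /\ P01plus A.

End Matrices.

(* A partial matrix has entries in [option R]; [None] means unspecified. *)
Section PartialMatrices.
Variables (R : realType) (n : nat).
Implicit Types (M : 'M[option R]_n) (B : 'M[R]_n) (S : {set 'I_n}).

Definition specified M (i j : 'I_n) : bool := M i j != None.

Definition completion_of M B : Prop :=
  forall i j x, M i j = Some x -> B i j = x.

Definition specified_twins_compatible M : Prop :=
  forall i j a b, i != j -> M i j = Some a -> M j i = Some b ->
    twin_compatible a b.

(* The default value 0 is irrelevant: the minor is only evaluated on sets S
   all of whose entries are specified. *)
Definition specified_minors_nonneg M : Prop :=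
  forall S, (forall i j, i \in S -> j \in S -> specified M i j) ->
    0 <= principal_minor (map_mx (odflt 0) M) S.

Definition partial_case_i M : Prop :=
  [/\ exists i, ~~ specified M i i,
      specified_twins_compatible M
    & specified_minors_nonneg M].

Definition partial_case_ii M : Prop :=
  [/\ forall i, exists2 a, M i i = Some a & 0 < a,
      exists i j, i != j /\ ~~ specified M i j,
      specified_twins_compatible M
    & specified_minors_nonneg M].

Definition partial_case_iii M : Prop :=
  exists2 B : 'M[R]_n, (forall i j, M i j = Some (B i j)) & ss_P01plus B.

Definition partial_ss_P01plus M : Prop :=
  [\/ [/\ partial_case_i M, ~ partial_case_ii M & ~ partial_case_iii M],
      [/\ ~ partial_case_i M, partial_case_ii M & ~ partial_case_iii M]
    | [/\ ~ partial_case_i M, ~ partial_case_ii M & partial_case_iii M]].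

Definition specifies M (D : rel 'I_n) : Prop :=
  forall i j, specified M i j = D i j.

End PartialMatrices.

Definition has_ss_P01plus_completion (R : realType) (n : nat) (D : rel 'I_n)
    : Prop :=
  forall M : 'M[option R]_n, partial_ss_P01plus M -> specifies M D ->
    exists2 B : 'M[R]_n, completion_of M B & ss_P01plus B.

(* Main.v *)
(* No diagonal entry is specified, so the diagonal is free. Fill an unspecified
   off-diagonal entry by its twin when that is specified, and by 0 otherwise,
   then put one constant t on the diagonal. Each principal minor is then the
   value at t of a monic characteristic polynomial, hence positive for large t. *)
Require Import Defs.
From mathcomp Require Import all_boot all_order all_algebra.
From mathcomp Require Import reals.

Set Implicit Arguments.
Unset Strict Implicit.
Unset Printing Implicit Defensive.

Import Order.TTheory GRing.Theory Num.Theory.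
Local Open Scope ring_scope.

Lemma horner_char_poly (R : comNzRingType) n (A : 'M[R]_n) (t : R) :
  (char_poly A).[t] = \det (t%:M - A).
Proof.
rewrite -horner_evalE -det_map_mx; congr (\det _).
by apply/matrixP=> i j; rewrite !mxE /= /horner_eval !hornerE hornerMn hornerX.
Qed.

(** There are only finitely many index sets, so a single [t] can pass the root bounds of all their
    characteristic polynomials. *)
Lemma principal_minors_gt0_large (R : realType) n (A : 'M[R]_n) :
  exists2 t : R, 0 < t & forall S, 0 < principal_minor (A + t%:M) S.
Proof.
pose A_ (S : {set 'I_n}) := mxsub (@enum_val _ (mem S)) (@enum_val _ (mem S)) A.
have bound S : {b | forall t, b <= t -> 0 < (char_poly (- A_ S)).[t]}.
  have [b bP] := monic_Cauchy_bound (char_poly_monic (- A_ S)).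
  by exists b => t; apply: bP.
(* The sum of absolute values dominates each bound; the summand 1 makes [t] positive. *)
exists (1 + \sum_S `|sval (bound S)|) => [|S].
  by rewrite ltr_pwDl // sumr_ge0.
set t := (1 + _).
(* The sign in [- A_ S] turns [t%:M - _] into a sum; since [enum_val] is injective, [t%:M] restricts
   to a scalar matrix on [S]. *)
have -> : principal_minor (A + t%:M) S = (char_poly (- A_ S)).[t].
  rewrite horner_char_poly opprK addrC; congr (\det _); apply/matrixP=> i j.
  by rewrite !mxE (inj_eq enum_val_inj).
apply: (svalP (bound S)); apply: le_trans (ler_norm _) _.
by rewrite /t (bigD1 S) //= addrCA lerDl addr_ge0 // sumr_ge0.
Qed.

Lemma P0plus_minors_gt0 (R : realType) n (A : 'M[R]_n) :
  (forall S, 0 < principal_minor A S) -> P0plus A.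
Proof.
move=> A_gt0 k /andP[_ le_kn]; split=> [S _|]; first exact: ltW.
(* Any set of size [k] would do; this one is the first [k] indices. *)
exists [set widen_ord le_kn x | x : 'I_k]; split=> //.
by rewrite card_imset ?card_ord // => x y /(congr1 val) /= /val_inj.
Qed.

Lemma twin_compatible_refl (R : realType) (a : R) : twin_compatible a a.
Proof.
by have [->|a0] := eqVneq a 0; [right | left; rewrite -expr2 exprn_even_gt0].
Qed.

Lemma partial_ss_P01plus_twins (R : realType) n (M : 'M[option R]_n) :
  partial_ss_P01plus M -> specified_twins_compatible M.
Proof.
case=> [[[] //]|[_ [] //]|[_ _ [B MB [ssB _]]]] i j a b ij.
by rewrite !MB => -[<-] [<-]; apply: ssB.
Qed.

Theorem theorem2p1 (R : realType) (n : nat) (D : rel 'I_n)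
    (D_loopless : forall i : 'I_n, ~~ D i i) :
  has_ss_P01plus_completion R D.
Proof.
move=> M /partial_ss_P01plus_twins twM MD.
pose C : 'M[R]_n := \matrix_(i, j)
  if i == j then 0 else odflt (odflt 0 (M j i)) (M i j).
have [t t_gt0 minors_gt0] := principal_minors_gt0_large C.
exists (C + t%:M) => [i j x Mij|].
  (* A loop-free [D] keeps specified entries off the diagonal, where adding [t%:M] changes
     nothing. *)
  have ij : i != j.
    by apply: contraNneq (D_loopless i) => ij; rewrite -MD /specified {2}ij Mij.
  by rewrite !mxE (negPf ij) Mij /= addr0.
split=> [i j ij|]; last first.
  by split=> [|i]; [exact: P0plus_minors_gt0 | rewrite !mxE eqxx add0r].
rewrite !mxE [j == i]eq_sym (negPf ij) !addr0.
(* Unless both twins are specified, the two filled entries are equal. *)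
case Mij: (M i j) => [a|]; case Mji: (M j i) => [b|] /=;
  try exact: twin_compatible_refl.
exact: twM ij Mij Mji.
Qed.
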